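(* Let $\Psi:\mathbb{R}^n\to\mathbb{R}\cup\{\infty\}$ be a proper, convex and lower semi-continuous function with proximal map $\sigma:=\mathrm{prox}_\Psi$. Then the gradient of the Bregman loss function $B_\Psi(x,z)$ with respect to its second argument is $$\nabla_2 B_\Psi(x,z)=\sigma(z)-x$$ for all $x\in\mathrm{dom}(\Psi)$ and all $z\in\mathbb{R}^n$.
   Context: $\|\cdot\|$ and $\langle\cdot,\cdot\rangle$ are the Euclidean norm and inner product on $\mathbb{R}^n$; $\mathrm{dom}(\Psi)=\{x:\Psi(x)<\infty\}$. Proximal map: $\mathrm{prox}_\Psi(z):=\arg\min_{u\in\mathbb{R}^n}\{\frac12\|u-z\|^2+\Psi(u)\}$. Fenchel conjugate: $F^*(y):=\sup_x\{\langle x,y\rangle-F(x)\}$. Bregman loss function: for $x,z\in\mathbb{R}^n$, $$B_\Psi(x,z):=\tfrac12\|x\|^2+\Psi(x)+\left(\tfrac12\|\cdot\|^2+\Psi\right)^*(z)-\langle x,z\rangle.$$ $\nabla_2$ denotes the gradient with respect to the second argument $z$, with $x$ fixed. *)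

(* Defs.v *)
From HB Require Import structures.
From mathcomp Require Import all_boot all_order all_algebra.
From mathcomp Require Import all_classical all_reals all_analysis.

Set Implicit Arguments.
Unset Strict Implicit.
Unset Printing Implicit Defensive.

Import Order.TTheory GRing.Theory Num.Theory.
Import numFieldNormedType.Exports.

Local Open Scope classical_set_scope.
Local Open Scope ring_scope.

(* R^n is 'rV[R]_n. The norm `|x| that the library puts on 'rV[R]_n is the sup
   norm, so the Euclidean one is defined separately; both induce the same
   topology and the same notion of differentiability. *)
Definition inner (R : realType) (n : nat) (x y : 'rV[R]_n) : R :=
  \sum_(i < n) x ord0 i * y ord0 i.

Definition enorm (R : realType) (n : nat) (x : 'rV[R]_n) : R :=
  Num.sqrt (inner x x).

Definition half_sq (R : realType) (n : nat) (x : 'rV[R]_n) : \bar R :=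
  (2^-1 * enorm x ^+ 2)%:E.

Definition edom (R : realType) (n : nat) (F : 'rV[R]_n -> \bar R) :
  set 'rV[R]_n := [set x | (F x < +oo)%E].

(* The first conjunct encodes that F takes its values in R \cup {+oo}. *)
Definition eproper (R : realType) (n : nat) (F : 'rV[R]_n -> \bar R) : Prop :=
  (forall x, F x != -oo%E) /\ edom F !=set0.

(* The library's [convex_function] only covers real-valued functions. *)
Definition econvex (R : realType) (n : nat) (F : 'rV[R]_n -> \bar R) : Prop :=
  forall (x y : 'rV[R]_n) (t : R), 0 < t -> t < 1 ->
    (F (t *: x + (1 - t) *: y)%R <= t%:E * F x + (1 - t)%:E * F y)%E.

Definition argmin (R : realType) (n : nat) (F : 'rV[R]_n -> \bar R) :
  set 'rV[R]_n := [set u | forall v, (F u <= F v)%E].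

(* The unique minimizer; the value 0 is taken when there is no minimizer or
   more than one. *)
Definition prox (R : realType) (n : nat) (Psi : 'rV[R]_n -> \bar R)
    (z : 'rV[R]_n) : 'rV[R]_n :=
  xget 0 [set p | argmin (fun u => half_sq (u - z)%R + Psi u)%E = [set p]].

Definition conjugate (R : realType) (n : nat) (F : 'rV[R]_n -> \bar R)
    (y : 'rV[R]_n) : \bar R :=
  ereal_sup (range (fun x => (inner x y)%:E - F x)%E).

Definition bregman (R : realType) (n : nat) (Psi : 'rV[R]_n -> \bar R)
    (x z : 'rV[R]_n) : \bar R :=
  (half_sq x + Psi x + conjugate (fun u => half_sq u + Psi u) z
   - (inner x z)%:E)%E.

(* An extended-real-valued f has gradient g at z when it is finite near z and
   Frechet differentiable there, with differential h |-> <g, h>. *)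
Definition has_gradient (R : realType) (n : nat) (f : 'rV[R]_n -> \bar R)
    (z g : 'rV[R]_n) : Prop :=
  (\forall z' \near z, f z' \is a fin_num) /\
  is_diff z (fun z' => fine (f z')) (fun h => inner g h).

(* Main.v *)
Require Import Defs.
From HB Require Import structures.
From mathcomp Require Import all_boot all_order all_algebra.
From mathcomp Require Import all_classical all_reals all_analysis.
From mathcomp Require Import ring lra.

(** Write [F = half_sq + Psi] and [p z = prox Psi z]. Up to terms that are
    constant or linear in [z], [bregman Psi x z] is the conjugate [F^* z], so
    the claim is that [F^*] has gradient [p z].

    The prox objective [u |-> |u - z|^2 / 2 + Psi u] differs from
    [F u - <u, z>] by a constant and is 1-strongly convex, so it grows
    quadratically away from its minimizer:
      [obj z (p z) + |u - p z|^2 / 2 <= obj z u]    ([prox_spec]).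
    In particular the supremum defining [F^* z] is attained at [p z]
    ([conjugate_prox]). Comparing the values attained at [p z] and [p (h + z)],
    using the growth inequality at both base points, gives
      [0 <= F^* (h + z) - F^* z - <p z, h> <= |h|^2 / 2],
    where the upper bound is [0 <= |p (h + z) - p z - h|^2]. A quadratic
    remainder is a little-o of [h], hence Frechet differentiability
    ([has_gradient_of_quadratic_bound]).

    Existence of the minimizer comes from completeness rather than compactness.
    The objective is bounded below, because lower semicontinuity bounds [Psi]
    below near one point of its domain and convexity spreads this to a bound
    that decreases at most linearly ([convex_lsc_minorant]), which the quadratic
    term dominates. By strong convexity the sublevel sets just above the infimum
    have diameters tending to 0, so they generate a Cauchy filter, and lower
    semicontinuity shows that its limit is a minimizer. *)

Set Implicit Arguments.
Unset Strict Implicit.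
Unset Printing Implicit Defensive.

Import Order.TTheory GRing.Theory Num.Theory.
Import numFieldNormedType.Exports.

Local Open Scope classical_set_scope.
Local Open Scope ring_scope.

(** * Euclidean inner product *)

Lemma innerC (R : realType) (n : nat) (x y : 'rV[R]_n) : inner x y = inner y x.
Proof. by apply: eq_bigr => i _; rewrite mulrC. Qed.

Lemma inner_linear (R : realType) (n : nat) (g : 'rV[R]_n) :
  linear (inner g : 'rV[R]_n -> R).
Proof.
move=> a u v; rewrite /inner scaler_sumr -big_split /=.
by apply: eq_bigr => i _; rewrite !mxE /GRing.scale /=; ring.
Qed.

HB.instance Definition _ (R : realType) (n : nat) (g : 'rV[R]_n) :=
  GRing.isLinear.Build R 'rV[R]_n R *%R (inner g) (inner_linear g).

Lemma innerDr (R : realType) (n : nat) (x y w : 'rV[R]_n) :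
  inner x (y + w) = inner x y + inner x w.
Proof. exact: linearD. Qed.

Lemma innerBr (R : realType) (n : nat) (x y w : 'rV[R]_n) :
  inner x (y - w) = inner x y - inner x w.
Proof. exact: linearB. Qed.

Lemma innerBl (R : realType) (n : nat) (x y w : 'rV[R]_n) :
  inner (x - y) w = inner x w - inner y w.
Proof. by rewrite innerC innerBr !(innerC _ w). Qed.

Lemma inner_subr_sq (R : realType) (n : nat) (u v : 'rV[R]_n) :
  inner (u - v) (u - v) = inner u u - 2 * inner u v + inner v v.
Proof. by rewrite innerBr !innerBl (innerC v u); ring. Qed.

Lemma inner_ge0 (R : realType) (n : nat) (x : 'rV[R]_n) : 0 <= inner x x.
Proof. by apply: sumr_ge0 => i _; rewrite -expr2 sqr_ge0. Qed.

Lemma inner_convex (R : realType) (n : nat) (u v : 'rV[R]_n) (t : R) :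
  inner (t *: u + (1 - t) *: v) (t *: u + (1 - t) *: v) =
  t * inner u u + (1 - t) * inner v v - t * (1 - t) * inner (u - v) (u - v).
Proof.
rewrite /inner !mulr_sumr -big_split -sumrB /=.
by apply: eq_bigr => i _; rewrite !mxE; ring.
Qed.

(** Together with [inner_le_norm_sq], this compares the Euclidean norm with the
    sup norm that defines the topology of row vectors. *)
Lemma norm_sq_le_inner (R : realType) (n : nat) (x : 'rV[R]_n) :
  `|x| ^+ 2 <= inner x x.
Proof.
have [->|x0] := eqVneq (`|x|) 0; first by rewrite expr0n inner_ge0.
have [[i j] /= xij] := mx_norm_neq0 x0.
have -> : `|x| = `|x i j| by exact: xij.
rewrite [i]ord1 /inner (bigD1 j)//= real_normK ?num_real// -expr2.
by rewrite lerDl sumr_ge0// => k _; rewrite -expr2 sqr_ge0.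
Qed.

Lemma inner_le_norm_sq (R : realType) (n : nat) (x : 'rV[R]_n) :
  inner x x <= n%:R * `|x| ^+ 2.
Proof.
have coord i : `|x ord0 i| <= `|x|.
  rewrite [leRHS]/Num.norm/= mx_normrE.
  exact: (le_bigmax _ (fun ij : 'I_1 * 'I_n => `|x ij.1 ij.2|) (ord0, i)).
rewrite mulr_natl -[X in _ *+ X]card_ord -sumr_const ler_sum// => i _.
by rewrite -expr2 -real_normK ?num_real// ler_sqr ?nnegrE.
Qed.

Lemma inner_continuous (R : realType) (n : nat) (g : 'rV[R]_n) :
  continuous (inner g : 'rV[R]_n -> R).
Proof.
move=> x.
have coord (i : 'I_n) : xpredT i ->
    (fun h : 'rV[R]_n => g ord0 i * h ord0 i) @ x --> g ord0 i * x ord0 i.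
  move=> _; apply: (@cvgMl_tmp R _ (nbhs x) (nbhs_filter x)).
  exact: coord_continuous.
exact: (cvg_big (@add_continuous R^o) (nbhs_filter x) coord).
Qed.

(** * Differentiability from a remainder estimate *)

Lemma is_diff_of_remainder (R : numFieldType) (V W : normedModType R)
    (f : V -> W) (L : {linear V -> W}) (x : V) :
  continuous L ->
  (forall e, 0 < e ->
    \forall h \near (0 : V), `|f (h + x) - f x - L h| <= e * `|h|) ->
  is_diff x f L.
Proof.
move=> Lc small.
have fo : f \o shift x = cst (f x) + L +o_ 0 id.
  apply/eqaddoP => e e0; near=> h.
  rewrite /= opprD !fctE /= addrA.
  by near: h; exact: small.
have df := diff_unique Lc fo.
by split=> //; apply/diff_locallyP; split; rewrite df.
Unshelve. all: by end_near. Qed.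

Lemma has_gradient_of_quadratic_bound (R : realType) (n : nat)
    (f : 'rV[R]_n -> \bar R) (z g : 'rV[R]_n) :
  (forall z', f z' \is a fin_num) ->
  (forall h, 0 <= fine (f (h + z)) - fine (f z) - inner g h
               <= 2^-1 * inner h h) ->
  has_gradient f z g.
Proof.
move=> ffin fq; split; first by apply: (@filterE _ (nbhs z) _ _ ffin).
apply: (@is_diff_of_remainder R 'rV[R]_n R^o _ (inner g)).
  exact: inner_continuous.
move=> e e0; near=> h.
have /andP[lo hi] := fq h.
rewrite ger0_norm// (le_trans hi)//.
have q := inner_le_norm_sq h.
(* [n%:R + 1] rather than [n%:R] keeps the radius meaningful when [n] is 0. *)
have hn : n%:R * `|h| <= e.
  have : `|h| <= e / (n%:R + 1).
    near: h; apply: (cvgr0_norm_le (fun h => h)); first exact: cvg_id.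
    by rewrite divr_gt0// ltr_wpDl.
  rewrite ler_pdivlMr ?ltr_wpDl//; have := normr_ge0 h.
  by rewrite mulrDr mulr1 [`|h| * _]mulrC; lra.
have := ler_wpM2r (normr_ge0 h) hn; have := inner_ge0 h.
move: q; rewrite expr2 mulrA; lra.
Unshelve. all: by end_near. Qed.

(** * The prox objective and its strong convexity *)

Lemma finite_on_edom (R : realType) (n : nat) (F : 'rV[R]_n -> \bar R)
    (u : 'rV[R]_n) :
  eproper F -> edom F u -> F u = (fine (F u))%:E.
Proof.
move=> [Fny _] uF; rewrite fineK// fin_numE Fny /=.
by move: uF; rewrite /edom /= lt_neqAle => /andP[].
Qed.

Lemma half_sqE (R : realType) (n : nat) (x : 'rV[R]_n) :
  half_sq x = (2^-1 * inner x x)%:E.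
Proof. by rewrite /half_sq /enorm sqr_sqrtr ?inner_ge0. Qed.

(** Real-valued so that all estimates are real arithmetic; it agrees with the
    extended-valued objective minimized by [prox] on [edom Psi] only. *)
Definition prox_objective (R : realType) (n : nat) (Psi : 'rV[R]_n -> \bar R)
    (z u : 'rV[R]_n) : R :=
  2^-1 * inner (u - z) (u - z) + fine (Psi u).

Lemma convex_on_edom (R : realType) (n : nat) (F : 'rV[R]_n -> \bar R)
    (u v : 'rV[R]_n) (t : R) :
  eproper F -> econvex F -> edom F u -> edom F v -> 0 < t -> t < 1 ->
  let w := t *: u + (1 - t) *: v in
  edom F w /\ fine (F w) <= t * fine (F u) + (1 - t) * fine (F v).
Proof.
move=> Fp Fc Du Dv t0 t1 w.
have Fw : (F w <= (t * fine (F u) + (1 - t) * fine (F v))%:E)%E.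
  have := Fc u v t t0 t1.
  by rewrite (@finite_on_edom _ _ F u)// (@finite_on_edom _ _ F v).
have Dw : edom F w by apply: le_lt_trans Fw _; rewrite ltry.
by split=> //; move: Fw; rewrite (@finite_on_edom _ _ F w)// lee_fin.
Qed.

(** The modulus of strong convexity is exactly that of the quadratic term, by
    the identity [inner_convex]; [Psi] contributes plain convexity. *)
Lemma prox_objective_strongly_convex (R : realType) (n : nat)
    (Psi : 'rV[R]_n -> \bar R) (z u v : 'rV[R]_n) (t : R) :
  eproper Psi -> econvex Psi -> edom Psi u -> edom Psi v -> 0 < t -> t < 1 ->
  let w := t *: u + (1 - t) *: v in
  edom Psi w /\
  prox_objective Psi z w <=
    t * prox_objective Psi z u + (1 - t) * prox_objective Psi z v
    - 2^-1 * (t * (1 - t)) * inner (u - v) (u - v).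
Proof.
move=> Fp Fc Du Dv t0 t1 w.
have [Dw Fw] := convex_on_edom Fp Fc Du Dv t0 t1.
split=> //; rewrite /prox_objective.
have -> : w - z = t *: (u - z) + (1 - t) *: (v - z).
  by apply/rowP => i; rewrite !mxE; ring.
rewrite inner_convex.
have -> : u - z - (v - z) = u - v by apply/rowP => i; rewrite !mxE; ring.
by move: Fw; rewrite -/w; lra.
Qed.

(** A substitute for the affine minorant given by Hahn-Banach. Lower
    semicontinuity gives [F > F x0 - 1] on a ball of radius [r] around [x0].
    From a point [u] outside it, move to the point [w] of the segment at
    distance [r / 2] from [x0]: convexity would make [F w] too small if [F u]
    were below [F x0] by more than a multiple of the distance. *)
Lemma convex_lsc_minorant (R : realType) (n : nat) (F : 'rV[R]_n -> \bar R)
    (x0 : 'rV[R]_n) :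
  eproper F -> econvex F -> lower_semicontinuous F -> edom F x0 ->
  exists c k : R, forall u, edom F u -> c - k * `|u - x0| <= fine (F u).
Proof.
move=> Fp Fc Fl D0; pose c := fine (F x0) - 1.
have cF : (c%:E < F x0)%E.
  by rewrite (@finite_on_edom _ _ F x0)// lte_fin /c; lra.
have [V /nbhs_ballP[r /= r0 rV] Vc] := Fl x0 c cF.
have near_x0 u : edom F u -> `|u - x0| < r -> c < fine (F u).
  move=> Du ur; rewrite -lte_fin -finite_on_edom//; apply/Vc/rV.
  by rewrite -ball_normE /= distrC.
exists c, (2 / r) => u Du.
have N0 := normr_ge0 (u - x0); have k0 : 0 < 2 / r by rewrite divr_gt0.
have [ur|ru] := ltP `|u - x0| r.
  have := near_x0 u Du ur; have := mulr_ge0 (ltW k0) N0; lra.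
set N := `|u - x0| in N0 ru *; have Npos : 0 < N by exact: lt_le_trans ru.
(* With this weight on [u], the segment point is at distance [r / 2] of [x0]. *)
pose t := r / (2 * N).
have t0 : 0 < t by rewrite divr_gt0// mulr_gt0.
have t1 : t < 1 by rewrite ltr_pdivrMr ?mulr_gt0//; lra.
have [Dw Fw] := convex_on_edom Fp Fc Du D0 t0 t1.
have /(near_x0 _ Dw) cw : `|t *: u + (1 - t) *: x0 - x0| < r.
  have -> : t *: u + (1 - t) *: x0 - x0 = t *: (u - x0).
    by apply/rowP => i; rewrite !mxE; ring.
  rewrite normrZ gtr0_norm// -/N /t.
  have -> : r / (2 * N) * N = r / 2 by field; rewrite gt_eqF.
  by lra.
have -> : 2 / r * N = t^-1 by rewrite /t; field; rewrite !gt_eqF.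
have : 0 < t * (fine (F u) - fine (F x0)) + 1 by rewrite /c in cw; lra.
rewrite -(pmulr_rgt0 (x := t^-1)) ?invr_gt0// mulrDr mulKf ?gt_eqF//.
by rewrite /c mulr1; lra.
Qed.

(** * Existence of the minimizer *)

Lemma prox_objective_bounded_below (R : realType) (n : nat)
    (Psi : 'rV[R]_n -> \bar R) (z : 'rV[R]_n) :
  eproper Psi -> econvex Psi -> lower_semicontinuous Psi ->
  exists m : R, forall u, edom Psi u -> m <= prox_objective Psi z u.
Proof.
move=> Fp Fc Fl; have [x0 D0] := Fp.2.
have [c [k ck]] := convex_lsc_minorant Fp Fc Fl D0.
exists (c - `|k| * `|z - x0| - 2^-1 * `|k| ^+ 2) => u Du.
have le_c := ck u Du; have q := norm_sq_le_inner (u - z).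
have tri : `|u - x0| <= `|u - z| + `|z - x0|.
  by rewrite -[u - x0](subrKA z) ler_normD.
have kle : k * `|u - x0| <= `|k| * (`|u - z| + `|z - x0|).
  apply: (le_trans (ler_norm _)); rewrite normrM normr_id.
  by apply: ler_wpM2l tri.
have := sqr_ge0 (`|u - z| - `|k|); rewrite /prox_objective sqrrB.
move: kle; rewrite mulrDr [`|u - z| * `|k|]mulrC mulr2n; lra.
Qed.

(** Lower semicontinuity of the objective, in the form needed at a limit of
    approximate minimizers: [Psi] is lower semicontinuous and the quadratic term
    is bounded below near [p] by its tangent at [p], a continuous function. *)
Lemma prox_objective_le_at_cluster (R : realType) (n : nat)
    (Psi : 'rV[R]_n -> \bar R) (z p : 'rV[R]_n) (m : R) :
  eproper Psi -> lower_semicontinuous Psi ->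
  (forall e V, 0 < e -> nbhs p V ->
    exists u, [/\ V u, edom Psi u & prox_objective Psi z u < m + e]) ->
  edom Psi p /\ prox_objective Psi z p <= m.
Proof.
move=> Fp Fl pm; pose b := m - 2^-1 * inner (p - z) (p - z).
have below (a : R) : (a%:E < Psi p)%E -> a <= b.
  move=> aP; apply/ler_addgt0Pr => e e0.
  have [V pV Va] := Fl p a aP.
  have e20 : 0 < e / 2 by rewrite divr_gt0.
  have /cvgrPdist_lt/(_ _ e20) pW := @inner_continuous _ _ (p - z) p.
  have [u [[Vu Wu] Du um]] := pm _ _ e20 (filterI pV pW).
  have := Va u Vu; rewrite (@finite_on_edom _ _ Psi u)// lte_fin => au.
  have q := inner_ge0 (u - p).
  move: Wu; rewrite /= -innerBr ltr_norml => /andP[_ Wu].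
  (* Expansion around [p]; dropping the last square leaves the tangent. *)
  have exp : inner (u - z) (u - z) = inner (p - z) (p - z)
      - 2 * inner (p - z) (p - u) + inner (u - p) (u - p).
    rewrite /inner mulr_sumr -sumrB -big_split /=.
    by apply: eq_bigr => i _; rewrite !mxE; ring.
  by move: um; rewrite /prox_objective exp /b; lra.
have Pb : (Psi p <= b%:E)%E.
  rewrite leNgt; apply/negP => bP.
  have [a ba aP] : exists2 a : R, b < a & (a%:E < Psi p)%E.
    case: (Psi p) bP => [y| |//].
      rewrite lte_fin => b_lt_y.
      by exists ((b + y) / 2); last rewrite lte_fin; lra.
    by move=> _; exists (b + 1); rewrite ?ltry//; lra.
  by have := below a aP; rewrite leNgt ba.
have Dp : edom Psi p by apply: le_lt_trans Pb _; rewrite ltry.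
split=> //; move: Pb; rewrite (@finite_on_edom _ _ Psi p)// lee_fin.
by rewrite /prox_objective /b; lra.
Qed.

(** Two points whose objectives are within [e] of the infimum have a midpoint
    whose objective is at least the infimum; strong convexity then forces them
    to be within [sqrt (8 * e)] of each other, which makes the filter of
    sublevel sets Cauchy. *)
Lemma prox_objective_has_minimizer (R : realType) (n : nat)
    (Psi : 'rV[R]_n -> \bar R) (z : 'rV[R]_n) :
  eproper Psi -> econvex Psi -> lower_semicontinuous Psi ->
  exists2 p, edom Psi p &
    forall u, edom Psi u -> prox_objective Psi z p <= prox_objective Psi z u.
Proof.
move=> Fp Fc Fl; have [x0 D0] := Fp.2.
have [b bG] := prox_objective_bounded_below z Fp Fc Fl.
set G := prox_objective Psi z in bG *; pose S := G @` edom Psi.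
have infS : has_inf S.
  split; first by exists (G x0), x0.
  by exists b => _ [u Du <-]; exact: bG.
have m_le u : edom Psi u -> inf S <= G u.
  by move=> Du; apply: ge_inf; [case: infS | exists u].
pose sub e := [set u | edom Psi u /\ G u < inf S + e].
pose F := filter_from [set e : R | 0 < e] sub.
have FF : ProperFilter F.
  apply: filter_from_proper; last first.
    move=> e e0; have [_ [u Du <-] ue] := inf_adherent e0 infS.
    by exists u; split.
  apply: filter_from_filter; first by exists 1 => /=; exact: ltr01.
  move=> e1 e2 /= e10 e20; exists (Num.min e1 e2) => /=.
    by rewrite lt_min e10.
  move=> u [Du uG]; have : Num.min e1 e2 <= e1 /\ Num.min e1 e2 <= e2.
    by rewrite !ge_min !lexx orbT.
  by move=> [h1 h2]; split; split=> //; lra.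
have sub_close e u v : sub e u -> sub e v -> `|u - v| ^+ 2 <= 8 * e.
  move=> [Du ue] [Dv ve]; have h0 : 0 < 2^-1 :> R by rewrite invr_gt0.
  have h1 : 2^-1 < 1 :> R by lra.
  have [Dw] := prox_objective_strongly_convex z Fp Fc Du Dv h0 h1.
  have := m_le _ Dw; have := norm_sq_le_inner (u - v).
  by rewrite -/G; lra.
have cF : cvg F.
  (* Any denominator above 8 makes the bound [8 * d] less than [e ^+ 2]. *)
  apply/cauchy_cvgP/cauchyP => e e0; pose d := e ^+ 2 / 16.
  have d0 : 0 < d by rewrite divr_gt0// exprn_gt0.
  have [_ [u Du <-] ue] := inf_adherent d0 infS.
  exists u, d => // v vd; rewrite -ball_normE /=.
  have uv := sub_close d u v (conj Du ue) vd.
  have e20 : 0 < e ^+ 2 by rewrite exprn_gt0.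
  rewrite -(@ltr_pXn2r _ 2)// ?nnegrE ?normr_ge0 ?(ltW e0)//.
  by apply: le_lt_trans uv _; rewrite /d; lra.
have [Dp pm] : edom Psi (lim F) /\ G (lim F) <= inf S.
  apply: prox_objective_le_at_cluster => // e V e0 pV.
  have sF : F (sub e) by exists e.
  by have [u [Vu [Du ue]]] := filter_ex (filterI (cF V pV) sF); exists u.
by exists (lim F) => // u Du; exact: le_trans pm (m_le u Du).
Qed.

(** Minimality of [p] against [t *: u + (1 - t) *: p] gives the inequality with
    the extra factor [1 - t]; then [t] tends to 0. *)
Lemma prox_objective_quadratic_growth (R : realType) (n : nat)
    (Psi : 'rV[R]_n -> \bar R) (z p u : 'rV[R]_n) :
  eproper Psi -> econvex Psi -> edom Psi p ->
  (forall v, edom Psi v -> prox_objective Psi z p <= prox_objective Psi z v) ->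
  edom Psi u ->
  prox_objective Psi z p + 2^-1 * inner (u - p) (u - p)
    <= prox_objective Psi z u.
Proof.
move=> Fp Fc Dp pmin Du; apply/ler_addgt0Pr => e e0.
have Q0 := inner_ge0 (u - p); set Q := inner _ _ in Q0 *.
have Qe0 : 0 < Q + e + 1 by lra.
(* Small enough for [t * Q <= e], and less than 1 even when [Q = 0]. *)
pose t := e / (Q + e + 1).
have t0 : 0 < t by rewrite divr_gt0.
have t1 : t < 1 by rewrite ltr_pdivrMr//; lra.
have tQ : t * Q <= e.
  rewrite /t mulrAC ler_pdivrMr// ler_wpM2l ?ltW//; lra.
have [Dw] := prox_objective_strongly_convex z Fp Fc Du Dp t0 t1.
rewrite -/Q; have := pmin _ Dw; set Gw := prox_objective Psi z (_ + _) => h1 h2.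
have : 0 <= t * (prox_objective Psi z u - prox_objective Psi z p
    - 2^-1 * (1 - t) * Q) by lra.
by rewrite pmulr_rge0//; lra.
Qed.

(** * The proximal map and the conjugate *)

(** Quadratic growth also makes the minimizer unique, so [prox] does not take
    its default value. *)
Lemma prox_spec (R : realType) (n : nat) (Psi : 'rV[R]_n -> \bar R)
    (z : 'rV[R]_n) :
  eproper Psi -> econvex Psi -> lower_semicontinuous Psi ->
  edom Psi (prox Psi z) /\
  forall u, edom Psi u ->
    prox_objective Psi z (prox Psi z)
      + 2^-1 * inner (u - prox Psi z) (u - prox Psi z)
    <= prox_objective Psi z u.
Proof.
move=> Fp Fc Fl; have [p Dp pmin] := prox_objective_has_minimizer z Fp Fc Fl.
have growth u := prox_objective_quadratic_growth (u := u) Fp Fc Dp pmin.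
have objE u : edom Psi u ->
    (half_sq (u - z) + Psi u)%E = (prox_objective Psi z u)%:E.
  by move=> Du; rewrite half_sqE (finite_on_edom Fp Du) -EFinD.
suff -> : prox Psi z = p by [].
have argminE : argmin (fun u => half_sq (u - z)%R + Psi u)%E = [set p].
  apply/seteqP; split => [u umin | _ -> v] /=; last first.
    rewrite objE//; have [vfin|] := ltP (Psi v) +oo%E.
      by rewrite objE// lee_fin pmin.
    by rewrite leye_eq => /eqP->; rewrite half_sqE addeC leey.
  have Du : edom Psi u.
    rewrite /edom /= ltey; apply/negP => /eqP uoo.
    by have := umin p; rewrite (objE p Dp) uoo half_sqE addeC.
  have := umin p; rewrite !objE// lee_fin => up.
  have := growth u Du; have := norm_sq_le_inner (u - p) => n1 n2.
  apply/eqP; rewrite -subr_eq0 -normr_eq0 -sqrf_eq0 eq_le sqr_ge0 andbT; lra.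
by apply: xget_subset1 => // q1 q2 /= -> /seteqP[+ _]; apply.
Qed.

(** [<u, z> - F u] is the constant [|z|^2 / 2] minus the prox objective, so the
    minimizer of the latter attains the supremum. *)
Lemma conjugate_prox (R : realType) (n : nat) (Psi : 'rV[R]_n -> \bar R)
    (z : 'rV[R]_n) :
  eproper Psi -> econvex Psi -> lower_semicontinuous Psi ->
  conjugate (fun u => half_sq u + Psi u)%E z =
  (inner (prox Psi z) z - 2^-1 * inner (prox Psi z) (prox Psi z)
    - fine (Psi (prox Psi z)))%:E.
Proof.
move=> Fp Fc Fl; have [Dp growth] := prox_spec z Fp Fc Fl.
set p := prox Psi z in Dp growth *.
have valE u : edom Psi u -> ((inner u z)%:E - (half_sq u + Psi u))%E =
    (inner u z - 2^-1 * inner u u - fine (Psi u))%:E.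
  move=> Du; rewrite half_sqE (finite_on_edom Fp Du) /=.
  by congr (_%:E); ring.
apply/eqP; rewrite eq_le; apply/andP; split; last first.
  by apply: ereal_sup_ubound; exists p; rewrite ?valE.
apply: ge_ereal_sup => _ [u _ <-].
have [Du|] := ltP (Psi u) +oo%E; last first.
  by rewrite leye_eq => /eqP->; rewrite half_sqE addeC /= leNye.
rewrite valE// lee_fin; have := growth u Du; have := inner_ge0 (u - p).
by rewrite /prox_objective !(inner_subr_sq _ z); lra.
Qed.

Theorem lemma8 (R : realType) (n : nat) (Psi : 'rV[R]_n -> \bar R)
    (Psi_proper : eproper Psi) (Psi_convex : econvex Psi)
    (Psi_lsc : lower_semicontinuous Psi) (x z : 'rV[R]_n) (x_dom : edom Psi x) :
  has_gradient (fun z' => bregman Psi x z') z (prox Psi z - x).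
Proof.
have bregmanE z' : bregman Psi x z' =
    (2^-1 * inner x x + fine (Psi x)
     + (inner (prox Psi z') z' - 2^-1 * inner (prox Psi z') (prox Psi z')
        - fine (Psi (prox Psi z'))) - inner x z')%:E.
  by rewrite /bregman half_sqE (finite_on_edom Psi_proper x_dom) conjugate_prox.
apply: has_gradient_of_quadratic_bound => [z'|h]; first by rewrite bregmanE.
rewrite !bregmanE /=.
have [Dp growth] := prox_spec z Psi_proper Psi_convex Psi_lsc.
have [Dp' growth'] := prox_spec (h + z) Psi_proper Psi_convex Psi_lsc.
set p := prox Psi z in Dp growth *; set p' := prox Psi (h + z) in Dp' growth' *.
have := growth p' Dp'; have := growth' p Dp.
have := inner_ge0 (p' - p - h); have := inner_ge0 (p' - p).
rewrite /prox_objective !inner_subr_sq !(innerDr, innerBl) (innerC p p').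
(* What remains is linear arithmetic in the following quantities. *)
move: (fine (Psi p)) (fine (Psi p')) (fine (Psi x)).
move: (inner p p) (inner p' p') (inner p' p) (inner x x) (inner h h).
move: (inner p z) (inner p' z) (inner x z) (inner z z) (inner (h + z) z).
move: (inner p h) (inner p' h) (inner x h) (inner (h + z) h).
by clear => *; apply/andP; split; lra.
Qed.
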